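(* Let $G$ be a finite nilpotent group which is not a $p$-group for any prime $p$. Then $\mathcal{D}(G)$ is connected and $\diam(\mathcal{D}(G))\le 4$.
   Context: The trivial group counts as a $p$-group. The power graph $\mathcal{P}(G)$ of a finite group $G$ is the simple graph with vertex set $G$ in which two distinct vertices are adjacent if one is a power of the other. The enhanced power graph $\mathcal{P}_E(G)$ is the simple graph with vertex set $G$ in which two distinct vertices $x,y$ are adjacent if $\langle x,y\rangle$ is cyclic. The difference graph $\mathcal{D}(G)$ is obtained from $\mathcal{P}_E(G)-\mathcal{P}(G)$ (vertex set $G$, edges those of $\mathcal{P}_E(G)$ that are not edges of $\mathcal{P}(G)$) by removing all isolated vertices. Here $\diam(\Gamma)$ denotes the diameter of a graph $\Gamma$, the greatest distance between two of its vertices. *)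

(* Defs.v *)
From mathcomp Require Import all_boot all_fingroup all_solvable.

Set Implicit Arguments.
Unset Strict Implicit.
Unset Printing Implicit Defensive.

Import GroupScope.

Record sgraph (T : finType) := SGraph {
  vset : {set T};
  adj : rel T;
  adj_sym : symmetric adj;
  adj_irr : irreflexive adj;
  adj_vset : forall x y, adj x y -> x \in vset
}.

Section Graphs.
Variable T : finType.
Implicit Type g : sgraph T.

(* The graph on the vertices of g with the edges of g that are not in h. *)
Definition edge_diff_rel g h : rel T := fun x y => adj g x y && ~~ adj h x y.

Lemma edge_diff_sym g h : symmetric (edge_diff_rel g h).
Proof. by move=> x y; rewrite /edge_diff_rel (adj_sym g) (adj_sym h). Qed.

Lemma edge_diff_irr g h : irreflexive (edge_diff_rel g h).
Proof. by move=> x; rewrite /edge_diff_rel adj_irr. Qed.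

Lemma edge_diff_vset g h x y : edge_diff_rel g h x y -> x \in vset g.
Proof. by case/andP=> /adj_vset. Qed.

Definition edge_diff g h : sgraph T :=
  SGraph (@edge_diff_sym g h) (@edge_diff_irr g h) (@edge_diff_vset g h).

Definition non_isolated g : {set T} := [set x in vset g | [exists y, adj g x y]].

Lemma adj_non_isolated g x y : adj g x y -> x \in non_isolated g.
Proof.
by move=> gxy; rewrite inE (adj_vset gxy); apply/existsP; exists y.
Qed.

Definition remove_isolated g : sgraph T :=
  SGraph (@adj_sym T g) (@adj_irr T g) (@adj_non_isolated g).

(* A connected graph is nonempty. *)
Definition connected g : Prop :=
  vset g != set0 /\ {in vset g &, forall x y, connect (adj g) x y}.

(* The least length of a walk from x to y. A shortest walk has no repeated    *)
(* vertex, so its length is less than #|T|; the value is #|T| exactly when    *)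
(* there is no walk from x to y.                                              *)
Definition dist g (x y : T) : nat :=
  find (fun n => [exists s : n.-tuple T, path (adj g) x s && (last x s == y)])
       (iota 0 #|T|).

Definition diam g : nat := \max_(x in vset g) \max_(y in vset g) dist g x y.

End Graphs.

Section GroupGraphs.
Variables (gT : finGroupType) (G : {group gT}).

Definition power_rel : rel gT := fun x y =>
  [&& x \in G, y \in G, x != y & (x \in <[y]>) || (y \in <[x]>)].

Lemma power_rel_sym : symmetric power_rel.
Proof.
move=> x y; rewrite /power_rel eq_sym orbC.
by case: (x \in G); case: (y \in G).
Qed.

Lemma power_rel_irr : irreflexive power_rel.
Proof. by move=> x; rewrite /power_rel eqxx /= !andbF. Qed.

Lemma power_rel_vset x y : power_rel x y -> x \in (G : {set gT}).
Proof. by case/and4P. Qed.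

Definition power_graph : sgraph gT :=
  SGraph power_rel_sym power_rel_irr power_rel_vset.

Definition enhanced_rel : rel gT := fun x y =>
  [&& x \in G, y \in G, x != y & cyclic <<[set x; y]>>].

Lemma enhanced_rel_sym : symmetric enhanced_rel.
Proof.
move=> x y; rewrite /enhanced_rel eq_sym setUC.
by case: (x \in G); case: (y \in G).
Qed.

Lemma enhanced_rel_irr : irreflexive enhanced_rel.
Proof. by move=> x; rewrite /enhanced_rel eqxx /= !andbF. Qed.

Lemma enhanced_rel_vset x y : enhanced_rel x y -> x \in (G : {set gT}).
Proof. by case/and4P. Qed.

Definition enhanced_power_graph : sgraph gT :=
  SGraph enhanced_rel_sym enhanced_rel_irr enhanced_rel_vset.

Definition difference_graph : sgraph gT :=
  remove_isolated (edge_diff enhanced_power_graph power_graph).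

End GroupGraphs.

(* Main.v *)
(* Every vertex x of D(G) has a neighbour of prime power order: if x is adjacent
   to y, then #[y] does not divide #[x], so that for some prime p the p-part
   of y is not a power of x, and this p-part is adjacent to x.
   Nontrivial elements of coprime orders are adjacent, since G is nilpotent.
   Hence two primary neighbours u, v of x, y are either adjacent, when they
   belong to distinct primes, or have a common neighbour, of order prime to p,
   when they are both p-elements. *)
Require Import Defs.
From mathcomp Require Import all_boot all_fingroup all_solvable.

Set Implicit Arguments.
Unset Strict Implicit.
Unset Printing Implicit Defensive.

Import GroupScope.

Lemma dist_le_walk (T : finType) (g : sgraph T) (x : T) (s : seq T) :
  path (adj g) x s -> dist g x (last x s) <= size s.
Proof.
move=> gs; rewrite /dist leqNgt; apply/negP=> lt_s.
(* [find] never exceeds the length [#|T|] of the searched list, so [size s] is itself an entry of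
   that list, at index [size s]; [s] satisfies the test there. *)
have lt_sT: size s < #|T|.
  by apply: leq_trans lt_s _; rewrite -[leqRHS](size_iota 0) find_size.
have := before_find 0 lt_s; rewrite nth_iota // add0n.
by move/existsP; case; exists (in_tuple s); rewrite gs eqxx.
Qed.

Section DifferenceGraph.

Variables (gT : finGroupType) (G : {group gT}).
Implicit Types (x y u v : gT) (p : nat).

Local Notation DG := (difference_graph G).

(** The condition [x != y] disappears because every element lies in its own cyclic subgroup. *)
Lemma adj_difference_graph x y :
  adj DG x y = [&& x \in G, y \in G, cyclic <<[set x; y]>>, x \notin <[y]>
                 & y \notin <[x]>].
Proof.
rewrite /= /edge_diff_rel /= /enhanced_rel /power_rel.
case: (x \in G) (y \in G) => [] [] //=.
by case: eqVneq => [->|_] /=; rewrite ?cycle_id ?andbF // negb_or.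
Qed.

Lemma difference_graph_primary_neighbour x : x \in vset DG ->
  exists2 p, prime p & exists2 u, p.-elt u & (u != 1) && adj DG x u.
Proof.
rewrite inE => /andP[_ /existsP[y]]; rewrite -[adj _ x y]/(adj DG x y).
rewrite adj_difference_graph => /and5P[Gx Gy cycC x'y y'x].
set C := <<_>> in cycC.
have sxC: <[x]> \subset C by rewrite cycle_subG mem_gen ?set21.
have syC: <[y]> \subset C by rewrite cycle_subG mem_gen ?set22.
(* Inside the cyclic group [C], containment of subgroups amounts to divisibility of their orders. *)
have ndvd_yx: ~~ (#[y] %| #[x]).
  by rewrite /order (cardSg_cyclic cycC) // cycle_subG.
have /allPn[p]: ~~ all (fun p => #[y]`_p %| #[x]) (primes #[y]).
  by apply: contra ndvd_yx => /allP dvd_x; apply/dvdn_partP.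
rewrite mem_primes => /and3P[p_pr _ _]; rewrite -order_constt => ndvd_ux.
have syu: y.`_p \in <[y]> by rewrite groupX ?cycle_id.
have x'u: y.`_p \notin <[x]> by apply: contra ndvd_ux; apply: order_dvdG.
exists p => //; exists y.`_p; first exact: p_elt_constt.
apply/andP; split; first by apply: contraNneq x'u => ->.
rewrite adj_difference_graph Gx groupX //= x'u andbT; apply/andP; split.
  apply: cyclicS cycC; rewrite gen_subG subUset !sub1set mem_gen ?set21 //.
  exact: subsetP syC _ syu.
by apply: contra x'y; apply: subsetP; rewrite cycle_subG.
Qed.

Lemma notin_cycle_coprime u v : coprime #[u] #[v] -> u != 1 -> u \notin <[v]>.
Proof.
move=> co_uv; apply: contra => vu; rewrite -order_eq1.
by have := order_dvdG vu; rewrite -/(#[v]) => /gcdn_idPl <-.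
Qed.

(** In a nilpotent group, elements of coprime orders commute, and two commuting cyclic subgroups of
    coprime orders generate a cyclic one. *)
Lemma adj_difference_graph_coprime u v :
  nilpotent G -> u \in G -> v \in G -> coprime #[u] #[v] ->
  u != 1 -> v != 1 -> adj DG u v.
Proof.
move=> nilG Gu Gv co_uv nt_u nt_v; rewrite adj_difference_graph Gu Gv.
rewrite !notin_cycle_coprime // 1?coprime_sym // !andbT /=.
have cuv: <[v]> \subset 'C(<[u]>).
  by apply: sub_nilpotent_cent2 nilG _ _ co_uv; rewrite cycle_subG.
have := cyclicY (cycle_cyclic u) (cycle_cyclic v) cuv co_uv.
by rewrite joing_idl joing_idr.
Qed.

(** Some prime [q] other than [p] divides the order of [G]; Cauchy's theorem gives [w] of order
    [q]. *)
Lemma exists_nontrivial_p'elt p : prime p -> ~~ p.-group G ->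
  exists2 w, w \in G & (w != 1) && p^'.-elt w.
Proof.
move=> p_pr; rewrite /pgroup /pnat cardG_gt0 => /allPn[q].
rewrite mem_primes => /and3P[q_pr _ q_dv] p'q.
have [w Gw ow] := Cauchy q_pr q_dv; exists w => //.
by rewrite -order_eq1 /p_elt ow pnatE // neq_ltn prime_gt1 ?orbT.
Qed.

Lemma difference_graph_short_walk x y :
  nilpotent G -> (forall p, prime p -> ~~ p.-group G) ->
  x \in vset DG -> y \in vset DG ->
  exists2 s, path (adj DG) x s & (last x s == y) && (size s <= 4)%N.
Proof.
move=> nilG not_pG.
move=> /difference_graph_primary_neighbour[p p_pr [u pu /andP[nt_u xu]]].
move=> /difference_graph_primary_neighbour[q q_pr [v qv /andP[nt_v yv]]].
have [_ Gu _ _ _] := and5P (etrans (esym (adj_difference_graph x u)) xu).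
have [_ Gv _ _ _] := and5P (etrans (esym (adj_difference_graph y v)) yv).
rewrite adj_sym in yv.
have [eq_pq | neq_pq] := eqVneq p q.
  (* The detour through [w] also covers the case where [u] and [v] coincide or are powers of one
     another. *)
  have [w Gw /andP[nt_w p'w]] := exists_nontrivial_p'elt p_pr (not_pG p p_pr).
  have uw: adj DG u w.
    exact: adj_difference_graph_coprime (pnat_coprime pu p'w) _ _.
  have wv: adj DG w v.
    apply: adj_difference_graph_coprime => //.
    by rewrite coprime_sym (pnat_coprime _ p'w) // eq_pq.
  by exists [:: u; w; v; y]; rewrite ?/path ?xu ?uw ?wv ?yv //= eqxx.
exists [:: u; v; y]; last by rewrite /= eqxx.
rewrite /path xu yv adj_difference_graph_coprime // (pnat_coprime pu) //.
by apply: sub_in_pnat qv => r _ /eqP->; rewrite !inE eq_sym.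
Qed.

Lemma difference_graph_neq0 :
  nilpotent G -> (forall p, prime p -> ~~ p.-group G) -> vset DG != set0.
Proof.
move=> nilG not_pG.
(* The trivial group is a p-group for every prime; 2 is an arbitrary choice. *)
have G_gt1: 1 < #|G|.
  by rewrite cardG_gt1; apply: contraNneq (not_pG 2 isT) => ->; apply: pgroup1.
have q_pr := pdiv_prime G_gt1.
have [u Gu ou] := Cauchy q_pr (pdiv_dvd _).
have [w Gw /andP[nt_w q'w]] := exists_nontrivial_p'elt q_pr (not_pG _ q_pr).
apply/set0Pn; exists u; apply: (@adj_vset _ DG u w).
apply: adj_difference_graph_coprime => //; last first.
  by rewrite -order_eq1 ou neq_ltn prime_gt1 ?orbT.
by apply: pnat_coprime q'w; rewrite ou pnat_id.
Qed.

End DifferenceGraph.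

Theorem theorem5p4 (gT : finGroupType) (G : {group gT})
    (nilG : nilpotent G)
    (not_pG : forall p : nat, prime p -> ~~ p.-group G) :
  connected (difference_graph G) /\ (diam (difference_graph G) <= 4)%N.
Proof.
split; first split; first exact: difference_graph_neq0.
  move=> x y Dx Dy; have [s Ds] := difference_graph_short_walk nilG not_pG Dx Dy.
  by case/andP=> /eqP<- _; apply/connectP; exists s.
apply/bigmax_leqP=> x Dx; apply/bigmax_leqP=> y Dy.
have [s Ds /andP[/eqP<-]] := difference_graph_short_walk nilG not_pG Dx Dy.
exact: leq_trans (dist_le_walk Ds).
Qed.
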